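(* Let $\mathcal{A}$ be an affine hyperplane arrangement in $\mathbb{R}^d$ whose characteristic polynomial is written in the form $\chi_{\mathcal{A}}(t)=\sum_{k=0}^d(-1)^{d-k}a_kt^k$. Then, for every $k\in\{0,\ldots,d\}$, the function $$\varphi_k(x):=\sum_{P\in\mathcal{R}(\mathcal{A})}\ \sum_{F\in\mathcal{F}_k(P)}\mathbf{1}_{F+N_F(P)}(x),\qquad x\in\mathbb{R}^d,$$ satisfies $$\varphi_k(x)=a_k\qquad\text{for all }x\in\mathbb{R}^d\setminus E_k,$$ where $$E_k=\bigcup_{P\in\mathcal{R}(\mathcal{A})}\ \bigcup_{F\in\mathcal{F}_k(P)}\partial\bigl(F+N_F(P)\bigr).$$ Also, $\varphi_k(x)\ge a_k$ for every $x\in\mathbb{R}^d$.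
   Context: An affine hyperplane arrangement $\mathcal{A}=\{H_1,\ldots,H_m\}$ in $\mathbb{R}^d$ is a finite collection of pairwise distinct affine hyperplanes (not required to pass through the origin). The closures of the connected components of $\mathbb{R}^d\setminus\bigcup_{i=1}^m H_i$ are called (closed) chambers; $\mathcal{R}(\mathcal{A})$ is the set of all closed chambers. Each chamber is a polyhedral set, i.e. an intersection of finitely many closed half-spaces. The characteristic polynomial of $\mathcal{A}$ is $$\chi_{\mathcal{A}}(t)=\sum_{\mathcal{B}\subset\mathcal{A}:\ \bigcap_{H\in\mathcal{B}}H\neq\varnothing}(-1)^{\#\mathcal{B}}\,t^{\dim\left(\bigcap_{H\in\mathcal{B}}H\right)},$$ where for $\mathcal{B}=\varnothing$ the intersection is $\mathbb{R}^d$, contributing the term $t^d$. The numbers $a_0,\ldots,a_d$ are defined by $\chi_{\mathcal{A}}(t)=\sum_{k=0}^d(-1)^{d-k}a_kt^k$. For a polyhedral set $P\subset\mathbb{R}^d$, $\mathcal{F}_k(P)$ is the set of its $k$-dimensional (nonempty) faces; $P$ is a face of itself. The relative interior $\operatorname{relint}F$ of a face $F$ consists of all points of $F$ not belonging to a face of strictly smaller dimension. The tangent cone of $P$ at a face $F$ is $T_F(P)=\{u\in\mathbb{R}^d:\exists\,\delta>0:\ f_0+\delta u\in P\}$, where $f_0\in\operatorname{relint}F$ is arbitrary (the result does not depend on the choice of $f_0$). The polar (dual) cone of a polyhedral cone $C$ is $C^\circ=\{z\in\mathbb{R}^d:\langle z,y\rangle\le 0\text{ for all }y\in C\}$, with $\langle\cdot,\cdot\rangle$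 the standard scalar product. The normal cone of $P$ at $F$ is $N_F(P)=(T_F(P))^\circ$. The sum $F+N_F(P)$ is the Minkowski sum, $\mathbf{1}_A$ is the indicator function of $A$, and $\partial A=A\setminus\operatorname{int}A$ is the boundary of $A$, where $\operatorname{int}$ denotes the interior in $\mathbb{R}^d$. *)

(* Defs.v *)
From HB Require Import structures.
From mathcomp Require Import all_boot all_order all_algebra.
From mathcomp Require Import all_classical all_reals all_analysis.

Set Implicit Arguments.
Unset Strict Implicit.
Unset Printing Implicit Defensive.

Import Order.TTheory GRing.Theory Num.Theory.
Import numFieldNormedType.Exports.

Local Open Scope classical_set_scope.
Local Open Scope ring_scope.

Definition dotv (R : realType) (d : nat) (u v : 'rV[R]_d) : R :=
  \sum_(i < d) u 0 i * v 0 i.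

(* The linear subspace parallel to the affine hull of S, that is, the least
   linear subspace containing all differences of points of S.  A least one
   exists and is unique, so the default value of xget is never used. *)
Definition direction (R : realType) (d : nat) (S : set 'rV[R]_d) :
    {vspace 'rV[R]_d} :=
  let contains_diffs (U : {vspace 'rV[R]_d}) :=
    forall x y, S x -> S y -> x - y \in U in
  xget 0%VS [set U | contains_diffs U /\
                     forall W, contains_diffs W -> (U <= W)%VS].

(* Dimension of the affine hull of S; only meaningful when S is nonempty. *)
Definition affdim (R : realType) (d : nat) (S : set 'rV[R]_d) : nat :=
  \dim (direction S).

Definition is_hyperplane (R : realType) (d : nat) (H : set 'rV[R]_d) : Prop :=
  exists (u : 'rV[R]_d) (c : R), u != 0 /\ H = [set x | dotv u x = c].

Definition is_arrangement (R : realType) (d m : nat)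
    (H : 'I_m -> set 'rV[R]_d) : Prop :=
  injective H /\ forall i, is_hyperplane (H i).

(* The intersection over the empty subset B is the whole space. *)
Definition flat (R : realType) (d m : nat) (H : 'I_m -> set 'rV[R]_d)
    (B : {set 'I_m}) : set 'rV[R]_d :=
  \bigcap_(i in [set i | i \in B]) H i.

Definition char_polynomial (R : realType) (d m : nat)
    (H : 'I_m -> set 'rV[R]_d) : {poly int} :=
  \sum_(B : {set 'I_m} | `[< flat H B !=set0 >])
    (-1) ^+ #|B| *: 'X^(affdim (flat H B)).

Definition arr_complement (R : realType) (d m : nat)
    (H : 'I_m -> set 'rV[R]_d) : set 'rV[R]_d :=
  ~` \bigcup_(i in [set: 'I_m]) H i.

Definition chambers (R : realType) (d m : nat) (H : 'I_m -> set 'rV[R]_d) :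
    set (set 'rV[R]_d) :=
  [set closure (connected_component (arr_complement H) x)
     | x in arr_complement H].

(* Nonempty faces of a polyhedral set: the set itself and its nonempty
   intersections with supporting hyperplanes. *)
Definition is_face (R : realType) (d : nat) (P F : set 'rV[R]_d) : Prop :=
  F !=set0 /\
  (F = P \/
   exists (u : 'rV[R]_d) (c : R),
     [/\ u != 0, forall y, P y -> dotv u y <= c &
         F = P `&` [set y | dotv u y = c]]).

Definition faces (R : realType) (d k : nat) (P : set 'rV[R]_d) :
    set (set 'rV[R]_d) :=
  [set F | is_face P F /\ affdim F = k].

Definition relint (R : realType) (d : nat) (F : set 'rV[R]_d) :
    set 'rV[R]_d :=
  [set x | F x /\ forall G, is_face F G -> (affdim G < affdim F)%N -> ~ G x].

Definition tangent_cone (R : realType) (d : nat) (P F : set 'rV[R]_d) :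
    set 'rV[R]_d :=
  [set u | exists2 f0, relint F f0 &
           exists2 delta : R, 0 < delta & P (f0 + delta *: u)].

Definition polar (R : realType) (d : nat) (C : set 'rV[R]_d) :
    set 'rV[R]_d :=
  [set z | forall y, C y -> dotv z y <= 0].

Definition normal_cone (R : realType) (d : nat) (P F : set 'rV[R]_d) :
    set 'rV[R]_d :=
  polar (tangent_cone P F).

Definition face_plus_normal (R : realType) (d : nat) (P F : set 'rV[R]_d) :
    set 'rV[R]_d :=
  [set f + z | f in F & z in normal_cone P F].

(* Not the topological frontier for arbitrary A (no closure is taken); the two
   agree on closed sets. *)
Definition boundary (R : realType) (d : nat) (A : set 'rV[R]_d) :
    set 'rV[R]_d :=
  A `\` interior A.

Definition phi (R : realType) (d m : nat) (H : 'I_m -> set 'rV[R]_d)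
    (k : nat) (x : 'rV[R]_d) : int :=
  \sum_(P \in chambers H) \sum_(F \in faces k P)
    (\1_(face_plus_normal P F) x : int).

Definition exceptional_set (R : realType) (d m : nat)
    (H : 'I_m -> set 'rV[R]_d) (k : nat) : set 'rV[R]_d :=
  \bigcup_(P in chambers H) \bigcup_(F in faces k P)
    boundary (face_plus_normal P F).

(* Main.v *)
Require Import Defs.
From HB Require Import structures.
From mathcomp Require Import all_boot all_order all_algebra.
From mathcomp Require Import all_classical all_reals all_analysis.
From mathcomp Require Import ring lra.
Import Order.TTheory GRing.Theory Num.Theory.
Import numFieldNormedType.Exports.
Local Open Scope classical_set_scope.
Local Open Scope ring_scope.

Set Implicit Arguments.
Unset Strict Implicit.
Unset Printing Implicit Defensive.

(** For a face F of a polyhedron P, a point x lies in F + N_F(P) only if the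
    point p of P nearest to x lies in F. If x is generic, meaning that its orthogonal
    projection to a flat lies on a wall only when the wall contains the flat,
    the face F is then the one having p in its relative interior
    (face_plus_normal_generic). So phi_k(x) is, for generic x, the number of
    chambers P whose point nearest to x lies in the relative interior of a
    k-dimensional face.

    This number obeys deletion and restriction (region_count_setU1). Let a wall
    h cut a region P into two halves, and let p and q be the points of P and of
    the slice of P by h nearest to x. The half containing p still has p as its
    nearest point; the other half has q, because a segment from any of its
    points to p crosses h. Genericity ensures that p keeps a face of the same
    dimension when h is added. Hence the count for the arrangement with h is
    the count without h plus the count for the arrangement induced on h.
    Whitney's sum defining the characteristic polynomial obeys the same
    recursion up to a sign, which comes from the dimension dropping by one on h
    (whitney_setU1), so induction on the number of walls identifies the count
    with a_k (whitney_region_count). For the induction to close, arrangements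
    are considered inside an arbitrary flat, and walls are allowed to coincide
    with each other, to contain the flat or to miss it; no region survives, and
    Whitney's sum vanishes, once a wall contains the flat.

    To pass to arbitrary x: generic points are dense (generic_dense) and each
    F + N_F(P) is closed (face_plus_normal_closed). A generic x' close enough to
    x therefore belongs to no more of these sets than x does, which gives
    a_k <= phi_k(x); and if x is on the boundary of none of them, it belongs to
    exactly the same ones (phi_near). *)

(** * Scalar product, linear constraints and orthogonal projection *)

Section ScalarProduct.
Variables (R : realType) (d : nat).
Implicit Types (x y v w : 'rV[R]_d) (a t : R).

Lemma dotvC x y : dotv x y = dotv y x.
Proof. by apply: eq_bigr => i _; rewrite mulrC. Qed.

Lemma dotvDr x y v : dotv x (y + v) = dotv x y + dotv x v.
Proof. by rewrite -big_split; apply: eq_bigr => i _; rewrite mxE mulrDr. Qed.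

Lemma dotvZr x a v : dotv x (a *: v) = a * dotv x v.
Proof. by rewrite big_distrr; apply: eq_bigr => i _; rewrite mxE mulrCA. Qed.

Lemma dotvNr x v : dotv x (- v) = - dotv x v.
Proof. by rewrite -scaleN1r dotvZr mulN1r. Qed.

Lemma dotvBr x y v : dotv x (y - v) = dotv x y - dotv x v.
Proof. by rewrite dotvDr dotvNr. Qed.

Lemma dotvDl x y v : dotv (x + y) v = dotv x v + dotv y v.
Proof. by rewrite ![dotv _ v]dotvC dotvDr. Qed.

Lemma dotvZl x a v : dotv (a *: x) v = a * dotv x v.
Proof. by rewrite ![dotv _ v]dotvC dotvZr. Qed.

Lemma dotvNl x v : dotv (- x) v = - dotv x v.
Proof. by rewrite ![dotv _ v]dotvC dotvNr. Qed.

Lemma dotvBl x y v : dotv (x - y) v = dotv x v - dotv y v.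
Proof. by rewrite dotvDl dotvNl. Qed.

Lemma dotv0r x : dotv x 0 = 0.
Proof. by rewrite -(scale0r 0) dotvZr mul0r. Qed.

Lemma dotv0l x : dotv 0 x = 0.
Proof. by rewrite dotvC dotv0r. Qed.

Lemma dotv_suml (I : finType) (Q : pred I) (F : I -> 'rV[R]_d) x :
  dotv (\sum_(i | Q i) F i) x = \sum_(i | Q i) dotv (F i) x.
Proof.
apply: (big_morph (fun y => dotv y x)) => [y z|]; first exact: dotvDl.
exact: dotv0l.
Qed.

Lemma dotv_ge0 x : 0 <= dotv x x.
Proof. by apply: sumr_ge0 => i _; rewrite -expr2 sqr_ge0. Qed.

Lemma dotv_eq0 x : dotv x x = 0 -> x = 0.
Proof.
move=> /eqP; rewrite psumr_eq0 => [/allP x0|i _];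
  last by rewrite -expr2 sqr_ge0.
apply/rowP => i; rewrite mxE; apply/eqP.
by have := x0 i (mem_index_enum _); rewrite mulf_eq0 orbb.
Qed.

Lemma dotv_le0 x : dotv x x <= 0 -> x = 0.
Proof. by move=> x0; apply: dotv_eq0; apply/eqP; rewrite eq_le x0 dotv_ge0. Qed.

Lemma dotv_Cauchy_Schwarz x y : dotv x y ^+ 2 <= dotv x x * dotv y y.
Proof.
have [->|y0] := eqVneq y 0; first by rewrite !dotv0r expr0n mulr0.
have yy0 : 0 < dotv y y.
  rewrite lt_neqAle dotv_ge0 andbT eq_sym.
  by apply: contra_neq y0 => /dotv_eq0.
have := dotv_ge0 (dotv y y *: x - dotv x y *: y).
rewrite !(dotvBl, dotvBr, dotvZl, dotvZr) (dotvC y x) => h.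
rewrite -subr_ge0 -(pmulr_rge0 _ yy0); move: h; congr (_ <= _); ring.
Qed.

End ScalarProduct.

(** The induction on the set of walls behind both the existence of nearest
    points and the main identity. *)
Lemma finset_ind (I : finType) (P : {set I} -> Prop) :
  P finset.set0 ->
  (forall j (J : {set I}), j \notin J -> P J -> P (j |: J)%SET) ->
  forall J, P J.
Proof.
move=> P0 PU J; have [n] := ubnP #|J|; elim: n J => // n IHn J leJn.
have [->|[j jJ]] := set_0Vmem J; first exact: P0.
rewrite -(finset.setD1K jJ); apply: PU; first by rewrite !inE eqxx.
by apply: IHn; move: leJn; rewrite (cardsD1 j J) jJ.
Qed.

(** The subsets of J with j adjoined either avoid j or contain it. Both sides of
    the main identity are sums over a powerset, and this one splitting yields
    deletion and restriction for each. *)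
Lemma sum_powersetU1 (I : finType) (V : nmodType) (j : I) (J : {set I})
    (F : {set I} -> V) : j \notin J ->
  \sum_(B in powerset (j |: J)) F B =
  \sum_(B in powerset J) (F B + F (j |: B)%SET).
Proof.
move=> jJ; rewrite big_split /= (bigID (fun B : {set I} => j \in B)) /= addrC.
congr (_ + _).
  apply: eq_bigl => B; rewrite !powersetE -[in RHS](finset.setU1K jJ)
    finset.subsetD1.
  by [].
rewrite (reindex_onto (fun B => j |: B)%SET (fun B => B :\ j)%SET) /=;
  last first.
  by move=> B /andP[_ jB]; rewrite finset.setD1K.
apply: eq_bigl => B; rewrite !powersetE finset.setU11 andbT.
apply/andP/idP => [[sB /eqP <-]|sB].
  by rewrite -[J](finset.setU1K jJ) finset.setSD.
have jB : j \notin B by apply: contra jJ => /(fintype.subsetP sB).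
by rewrite finset.setU1K // finset.setUS.
Qed.

(** The finiteness of the number of walls enters here: one step size serves all
    the constraints that are strict at a given point. *)
Lemma small_step (R : realType) (I : finType) (Q : pred I) (a b : I -> R) :
  (forall i, Q i -> 0 < a i) ->
  exists2 e, 0 < e & forall i, Q i -> 0 < a i + e * b i.
Proof.
move=> a0.
pose M := \sum_(i | Q i) `|b i| / a i.
have M0 : 0 <= M by apply: sumr_ge0 => i Qi; rewrite divr_ge0 ?(ltW (a0 i Qi)).
(* This step size makes e * `|b i| less than a i, as `|b i| / a i <= M. *)
exists (1 + M)^-1 => [|i Qi]; first by rewrite invr_gt0; lra.
have ai := a0 i Qi; have M1 : 0 < 1 + M by lra.
have leM : `|b i| / a i <= M.
  rewrite /M (bigD1 i) //= lerDl; apply: sumr_ge0 => l /andP[Ql _].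
  by rewrite divr_ge0 ?(ltW (a0 l Ql)).
have -> : a i + (1 + M)^-1 * b i = (1 + M)^-1 * ((1 + M) * a i + b i).
  by field; apply: lt0r_neq0.
rewrite mulr_gt0 ?invr_gt0 //.
rewrite ler_pdivrMr // in leM.
have := ler_norm (- b i); rewrite normrN; nra.
Qed.

Section LinearForm.
Variables (R : realType) (d : nat) (v : 'rV[R]_d).

Definition linform (w : 'rV[R]_d) : R^o := dotv v w.

Lemma linform_is_linear : linear linform.
Proof. by move=> a x y; rewrite /linform dotvDr dotvZr. Qed.

HB.instance Definition _ :=
  GRing.isLinear.Build R 'rV[R]_d R^o *:%R linform linform_is_linear.

End LinearForm.

Section LinearConstraints.
Variables (R : realType) (d : nat) (I : finType) (u : I -> 'rV[R]_d).
Implicit Types (B : {set I}) (v w x : 'rV[R]_d).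

(** The direction space of the flat of B, whatever the offsets of its walls. *)
Definition dir B : {vspace 'rV[R]_d} :=
  (\bigcap_(i in B) lker (linfun (linform (u i))))%VS.

Lemma dirP B v : reflect (forall i, i \in B -> dotv (u i) v = 0) (v \in dir B).
Proof.
rewrite memvE; apply: (iffP subv_bigcapP) => vB i iB.
  by have := vB i iB; rewrite -memvE memv_ker lfunE => /eqP.
by rewrite -memvE memv_ker lfunE /= /linform vB.
Qed.

(** Orthogonal projection onto a linear subspace, by Gram-Schmidt. *)
Lemma dir_proj B x : exists w, w \in dir B /\
  forall v, v \in dir B -> dotv (x - w) v = 0.
Proof.
elim/finset_ind: B x => [|j B jB IH] x.
  exists x; split => [|v _]; last by rewrite subrr dotv0l.
  by apply/dirP => i; rewrite inE.
have dirU v : v \in dir (j |: B) -> v \in dir B /\ dotv (u j) v = 0.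
  move=> /dirP vB; split; last by apply: vB; rewrite !inE eqxx.
  by apply/dirP => i iB; apply: vB; rewrite !inE iB orbT.
have [w [wB xw]] := IH x; have [g [gB ug]] := IH (u j).
have [g0|g0] := eqVneq g 0.
  exists w; split; last by move=> v /dirU[vB _]; apply: xw.
  apply/dirP => i /finset.setU1P[->|]; last by move/dirP: wB; apply.
  by have := ug w wB; rewrite g0 subr0.
have gg0 : dotv g g != 0 by apply: contra_neq g0 => /dotv_eq0.
have ugg : dotv (u j) g = dotv g g by apply/eqP; rewrite -subr_eq0 -dotvBl ug.
exists (w - (dotv (u j) w / dotv g g) *: g); split.
  apply/dirP => i /finset.setU1P[->|iB].
    by rewrite dotvBr dotvZr ugg divfK // subrr.
  by rewrite dotvBr dotvZr (dirP _ _ wB) // (dirP _ _ gB) // mulr0 subrr.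
move=> v /dirU[vB uv].
have gv : dotv g v = 0.
  by have := ug v vB; rewrite dotvBl uv sub0r => /eqP; rewrite oppr_eq0 => /eqP.
by rewrite opprB addrCA dotvDl xw // dotvZl gv mulr0 addr0.
Qed.

Lemma dir_setU1 j B : dir (j |: B)%SET =
  (dir B :&: lker (linfun (linform (u j))))%VS.
Proof.
apply/vspaceP => v; rewrite memv_cap memv_ker lfunE /= /linform.
apply/dirP/andP => [vB|[/dirP vB /eqP uv] i /finset.setU1P[->//|/vB//]].
split; last by apply/eqP/vB; rewrite !inE eqxx.
by apply/dirP => i iB; apply: vB; rewrite !inE iB orbT.
Qed.

Lemma dim_dir_setU1 j B v : v \in dir B -> dotv (u j) v != 0 ->
  \dim (dir B) = (\dim (dir (j |: B)%SET)).+1.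
Proof.
move=> vB uv; rewrite dir_setU1.
rewrite -(limg_ker_dim (linfun (linform (u j))) (dir B)).
rewrite -[RHS]addn1; congr addn.
apply/eqP; rewrite eqn_leq; apply/andP; split.
  by apply: leq_trans (dimvS (subvf _)) _; rewrite dimvf.
have dim1 : \dim <[dotv (u j) v : R^o]> = 1%N by rewrite dim_vline uv.
apply: leq_trans (eq_leq (esym dim1)) _; apply: dimvS; rewrite -memvE.
by have := memv_img (linfun (linform (u j))) vB; rewrite lfunE.
Qed.

Lemma dim_dir0 : \dim (dir finset.set0) = d.
Proof. by rewrite /dir big_set0 dimvf /dim /= mul1n. Qed.

End LinearConstraints.

(** * Nearest points and regions of an arrangement restricted to a flat *)

Section NearestPoint.
Variables (R : realType) (d : nat).
Implicit Types (P : set 'rV[R]_d) (x y p q : 'rV[R]_d).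

(** The variational form of p being the point of P nearest to x; for convex P
    it is equivalent to minimality of the distance, and it avoids square
    roots. *)
Definition isproj P x p := P p /\ forall y, P y -> dotv (x - p) (y - p) <= 0.

(** The nearest point map is firmly nonexpansive, whence its uniqueness and, by
    Cauchy-Schwarz, its continuity. *)
Lemma isproj_le P x1 x2 p1 p2 : isproj P x1 p1 -> isproj P x2 p2 ->
  dotv (p1 - p2) (p1 - p2) <= dotv (x1 - x2) (p1 - p2).
Proof.
move=> [P1 le1] [P2 le2]; have := le1 _ P2; have := le2 _ P1.
rewrite -(opprB p1 p2) dotvNr !dotvBl; lra.
Qed.

Lemma isproj_uniq P x p q : isproj P x p -> isproj P x q -> p = q.
Proof.
move=> xp xq; apply/eqP; rewrite -subr_eq0; apply/eqP/dotv_le0.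
by have := isproj_le xp xq; rewrite subrr dotv0l.
Qed.

Lemma isproj_sub P (Q : set 'rV[R]_d) x p :
  isproj P x p -> Q `<=` P -> Q p -> isproj Q x p.
Proof. by move=> [_ le_p] QP Qp; split=> // y /QP; apply: le_p. Qed.

(** When the point p of P nearest to x lies on the nonnegative side of g, the
    segment from p to a point of the negative side meets the wall g = 0, so
    that the part of P on the negative side is best approached on the wall. *)
Lemma isproj_cut P (g : 'rV[R]_d -> R) x p q :
  (forall y z t, P y -> P z -> 0 <= t <= 1 -> P (y + t *: (z - y))) ->
  (forall y z t, g (y + t *: (z - y)) = g y + t * (g z - g y)) ->
  isproj P x p -> 0 <= g p -> isproj (P `&` [set y | g y = 0]) x q ->
  isproj (P `&` [set y | g y <= 0]) x q.
Proof.
move=> cvxP affg xp gp0 xq; have [[Pq gq] le_q] := xq; have [Pp le_p] := xp.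
split; first by split; rewrite //= gq.
move=> y [Py gy]; have [gy0|gyN] := eqVneq (g y) 0; first exact: le_q.
have {}gy : g y < 0 by rewrite lt_neqAle gyN.
have [gp|gpN] := eqVneq (g p) 0.
  have xp' : isproj (P `&` [set y | g y = 0]) x p.
    by apply: (isproj_sub xp) => // z [].
  by rewrite (isproj_uniq xq xp'); apply: le_p.
have {gp0 gpN}gp : 0 < g p by rewrite lt_neqAle eq_sym gpN.
have D0 : 0 < g p - g y by lra.
(* The segment from y to p crosses the wall at parameter t < 1. *)
pose t := - g y / (g p - g y).
have tD : t * (g p - g y) = - g y by rewrite /t divfK // lt0r_neq0.
have t0 : 0 <= t by rewrite /t divr_ge0 // ?ltW // oppr_gt0.
have t1 : t < 1 by rewrite /t ltr_pdivrMr //; lra.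
have le_z : (1 - t) * dotv (x - q) (y - q) + t * dotv (x - q) (p - q) <= 0.
  rewrite -!dotvZr -dotvDr.
  have -> : (1 - t) *: (y - q) + t *: (p - q) = y + t *: (p - y) - q.
    by apply/rowP => i; rewrite !mxE; ring.
  apply: le_q; split; first by apply: cvxP => //; rewrite t0 ltW.
  by rewrite /= affg tD subrr.
have := le_p q Pq; rewrite -(opprB p q) dotvNr => le_pq.
have : dotv (x - q) (p - q) = dotv (x - p) (p - q) + dotv (p - q) (p - q).
  by rewrite -dotvDl addrA subrK.
have := dotv_ge0 (p - q); nra.
Qed.

End NearestPoint.

Section Regions.
Variables (R : realType) (d : nat) (I : finType).
Variables (u : I -> 'rV[R]_d) (c : I -> R).
Implicit Types (A B C J S T : {set I}) (x y z p q v w : 'rV[R]_d) (i j : I).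
Local Notation dir := (dir u).

Definition wall_form i x := dotv (u i) x - c i.

Definition side S i x := if i \in S then wall_form i x else - wall_form i x.

Definition flatc C := [set x | forall i, i \in C -> wall_form i x = 0].

(** Regions of the arrangement induced on the flat of C by the walls with
    indices in J. A sign vector is encoded as the set S of walls on whose
    positive side the region lies, so that sums over regions and Whitney's sum
    range over the same index type. *)
Definition closed_region C J S :=
  [set x | flatc C x /\ forall i, i \in J -> 0 <= side S i x].
Definition open_region C J S :=
  [set x | flatc C x /\ forall i, i \in J -> 0 < side S i x].

(** The walls through x, which determine the smallest face containing x. *)
Definition active_walls J x := [set i in J | wall_form i x == 0]%SET.

Lemma wall_form_line i p t v :
  wall_form i (p + t *: v) = wall_form i p + t * dotv (u i) v.
Proof. by rewrite /wall_form dotvDr dotvZr addrAC. Qed.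

Lemma dotv_wall_formB i x y :
  dotv (u i) (x - y) = wall_form i x - wall_form i y.
Proof. by rewrite /wall_form dotvBr; ring. Qed.

Lemma side_line S i p t v : side S i (p + t *: v) =
  side S i p + t * (if i \in S then dotv (u i) v else - dotv (u i) v).
Proof. by rewrite /side; case: ifP => _; rewrite wall_form_line; ring. Qed.

Lemma side_affine S i y z t :
  side S i (y + t *: (z - y)) = side S i y + t * (side S i z - side S i y).
Proof.
by rewrite side_line /side; case: ifP => _; rewrite dotv_wall_formB; ring.
Qed.

Lemma side_eq0 S i x : (side S i x == 0) = (wall_form i x == 0).
Proof. by rewrite /side; case: ifP; rewrite ?oppr_eq0. Qed.

Lemma side_opp S T i x : (i \in S) = (i \notin T) -> side S i x = - side T i x.
Proof. by rewrite /side => ->; case: (i \in T); rewrite ?opprK. Qed.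

Lemma active_wallsP J x i :
  reflect (i \in J /\ wall_form i x = 0) (i \in active_walls J x).
Proof. by rewrite inE; apply: (iffP andP) => -[? /eqP]. Qed.

Lemma flatc_dir C x y : flatc C x -> flatc C y -> x - y \in dir C.
Proof.
by move=> Cx Cy; apply/dirP => i iC; rewrite dotv_wall_formB Cx // Cy // subrr.
Qed.

Lemma flatc_line C x v t : flatc C x -> v \in dir C -> flatc C (x + t *: v).
Proof.
by move=> Cx /dirP vC i iC; rewrite wall_form_line Cx // vC // mulr0 addr0.
Qed.

Lemma flatcU A B x : flatc (A :|: B)%SET x <-> flatc A x /\ flatc B x.
Proof.
split=> [ABx|[Ax Bx] i /finset.setUP[/Ax|/Bx]//].
by split=> i iA; apply: ABx; rewrite inE iA ?orbT.
Qed.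

Lemma flatcU1 j C x : flatc (j |: C)%SET x <-> flatc C x /\ wall_form j x = 0.
Proof.
rewrite flatcU; split=> -[jx Cx]; split=> //; first by apply: jx; rewrite inE.
by move=> i /finset.set1P ->.
Qed.

Lemma flatc_active_walls J x : flatc (active_walls J x) x.
Proof. by move=> i /active_wallsP[]. Qed.

Lemma open_regionW C J S : open_region C J S `<=` closed_region C J S.
Proof. by move=> x [Cx Sx]; split=> // i /Sx /ltW. Qed.

Lemma closed_region_segment C J S y z t : closed_region C J S y ->
  closed_region C J S z -> 0 <= t <= 1 ->
  closed_region C J S (y + t *: (z - y)).
Proof.
move=> [Cy Sy] [Cz Sz] t01; split; first exact/flatc_line/flatc_dir.
by move=> i iJ; rewrite side_affine; have := Sy _ iJ; have := Sz _ iJ; nra.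
Qed.

Lemma open_region_segment C J S y z t : closed_region C J S y ->
  open_region C J S z -> 0 < t <= 1 ->
  open_region C J S (y + t *: (z - y)).
Proof.
move=> [Cy Sy] [Cz Sz] t01; split; first exact/flatc_line/flatc_dir.
by move=> i iJ; rewrite side_affine; have := Sy _ iJ; have := Sz _ iJ; nra.
Qed.

Lemma open_region_step C J S p v : open_region C J S p -> v \in dir C ->
  exists2 e, 0 < e & open_region C J S (p + e *: v).
Proof.
move=> [Cp Sp] vC.
have [e e0 eP] := @small_step R I (mem J) (fun i => side S i p)
  (fun i => if i \in S then dotv (u i) v else - dotv (u i) v) Sp.
by exists e => //; split; [exact: flatc_line|move=> i /eP; rewrite side_line].
Qed.

(** Inside a closed region one can move a little along every direction that
    keeps the active constraints active. *)
Lemma closed_region_step C J S p v : closed_region C J S p ->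
  v \in dir (C :|: active_walls J p)%SET ->
  exists2 e, 0 < e & closed_region C J S (p + e *: v).
Proof.
move=> [Cp Sp] /dirP vC.
have [|e e0 eP] := @small_step R I [pred i in J | i \notin active_walls J p]
    (fun i => side S i p)
    (fun i => if i \in S then dotv (u i) v else - dotv (u i) v).
  move=> i /andP[iJ ia]; rewrite lt_neqAle Sp // andbT eq_sym side_eq0.
  by apply: contra ia => /eqP i0; apply/active_wallsP.
exists e => //; split.
  by apply: flatc_line => //; apply/dirP => i iC; rewrite vC // inE iC.
move=> i iJ; rewrite side_line; have [ia|ia] := boolP (i \in active_walls J p).
  have -> : dotv (u i) v = 0 by apply: vC; rewrite inE ia orbT.
  by rewrite oppr0 if_same mulr0 addr0 Sp.
by rewrite ltW // eP //= iJ.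
Qed.

Lemma closed_region_agree C J S T : {in J, forall i, (i \in S) = (i \in T)} ->
  closed_region C J S = closed_region C J T.
Proof.
move=> ST; apply/seteqP; split=> x [Cx Sx]; split=> // i iJ;
by have := Sx _ iJ; rewrite /side ST.
Qed.

Lemma open_region_agree C J S T : {in J, forall i, (i \in S) = (i \in T)} ->
  open_region C J S = open_region C J T.
Proof.
move=> ST; apply/seteqP; split=> x [Cx Sx]; split=> // i iJ;
by have := Sx _ iJ; rewrite /side ST.
Qed.

Lemma closed_regionU1 j C J S : closed_region C (j |: J)%SET S =
  closed_region C J S `&` [set x | 0 <= side S j x].
Proof.
apply/seteqP; split=> x.
  move=> [Cx Sx]; split; last by apply: Sx; rewrite !inE eqxx.
  by split=> // i iJ; apply: Sx; rewrite !inE iJ orbT.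
by move=> [[Cx Sx] jx]; split=> // i /finset.setU1P[->//|/Sx].
Qed.

Lemma open_regionU1 j C J S : open_region C (j |: J)%SET S =
  open_region C J S `&` [set x | 0 < side S j x].
Proof.
apply/seteqP; split=> x.
  move=> [Cx Sx]; split; last by apply: Sx; rewrite !inE eqxx.
  by split=> // i iJ; apply: Sx; rewrite !inE iJ orbT.
by move=> [[Cx Sx] jx]; split=> // i /finset.setU1P[->//|/Sx].
Qed.

Lemma closed_region_restrict j C J S T : closed_region (j |: C)%SET J S =
  closed_region C J S `&` [set x | side T j x = 0].
Proof.
apply/seteqP; split=> x.
  move=> [/flatcU1[Cx jx] Sx]; split=> //; apply/eqP.
  by rewrite side_eq0 jx.
by move=> [[Cx Sx] /eqP]; rewrite side_eq0 => /eqP jx; split=> //;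
  apply/flatcU1.
Qed.

Lemma open_region_restrict j C J S x : open_region (j |: C)%SET J S x <->
  open_region C J S x /\ wall_form j x = 0.
Proof.
split=> [[/flatcU1[Cx jx] Sx]|[[Cx Sx] jx]]; first by [].
by split=> //; apply/flatcU1.
Qed.

Lemma isproj_flat C x : flatc C !=set0 -> exists p, isproj (flatc C) x p.
Proof.
move=> [p0 Cp0]; have [w [wC xw]] := dir_proj u C (x - p0).
exists (p0 + w); split; first by rewrite -(scale1r w); apply: flatc_line.
move=> y Cy; rewrite opprD !addrA xw //.
by rewrite rpredB //; apply: flatc_dir.
Qed.

(** Adding a half-space either keeps the nearest point, or moves it to the
    bounding hyperplane; so nearest points exist by induction on the number of
    half-spaces, starting from flats. *)
Lemma isproj_exists C J S x :
  closed_region C J S !=set0 -> exists p, isproj (closed_region C J S) x p.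
Proof.
elim/finset_ind: J C => [|j J jJ IH] C.
  have -> : closed_region C finset.set0 S = flatc C.
    apply/seteqP; split=> [y []//|y Cy].
    by split=> // i; rewrite inE.
  exact: isproj_flat.
rewrite closed_regionU1 => -[y [Sy jy]].
have [|p xp] := IH C; first by exists y.
have [jp|jp] := leP 0 (side S j p).
  by exists p; apply: (isproj_sub xp) => [? []//|]; split=> //; case: xp.
have [|q xq] := IH (j |: C)%SET.
  have D0 : side S j y - side S j p != 0.
    by apply: lt0r_neq0; have := jy; rewrite /=; lra.
  exists (p + (- side S j p / (side S j y - side S j p)) *: (y - p)).
  rewrite (closed_region_restrict _ _ _ _ S); split; last first.
    by rewrite /= side_affine divfK // subrr.
  apply: closed_region_segment => //; first by case: xp.
  rewrite /= in jy; rewrite divr_ge0 ?ler_pdivrMr; lra.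
exists q; rewrite (closed_region_restrict _ _ _ _ S) in xq.
have -> : [set x | 0 <= side S j x] = [set x | - side S j x <= 0].
  by apply/seteqP; split=> z /=; rewrite oppr_le0.
apply: (@isproj_cut _ _ _ _ _ p) => //.
- by move=> *; apply: closed_region_segment.
- by move=> *; rewrite side_affine; ring.
- by rewrite oppr_ge0 ltW.
have <- : [set x | side S j x = 0] = [set x | - side S j x = 0].
  apply/seteqP; split=> z /=; first by move=> ->; rewrite oppr0.
  by move/eqP; rewrite oppr_eq0 => /eqP.
by [].
Qed.

End Regions.

(** * Counting regions by deletion and restriction *)

Section Counting.
Variables (R : realType) (d : nat) (I : finType).
Variables (u : I -> 'rV[R]_d) (c : I -> R).
Implicit Types (A B C J S T : {set I}) (x y z p q v w : 'rV[R]_d) (i j : I).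
Local Notation dir := (dir u).
Local Notation wall_form := (wall_form u c).
Local Notation side := (side u c).
Local Notation flatc := (flatc u c).
Local Notation closed_region := (closed_region u c).
Local Notation open_region := (open_region u c).
Local Notation active_walls := (active_walls u c).

(** Genericity is stated through the orthogonal projection p of x to the flat
    of B: p may lie on a wall only if the whole flat does. *)
Definition generic x := forall B j p, flatc B p ->
  (forall v, v \in dir B -> dotv (x - p) v = 0) -> wall_form j p = 0 ->
  forall y, flatc B y -> wall_form j y = 0.

(** The dimension of the face having p in its relative interior: it spans the
    flat of all equations and walls that hold at p. *)
Definition face_dim C J p := \dim (dir (C :|: active_walls J p)%SET).

Definition counted k C J S x : bool :=
  `[< open_region C J S !=set0 >] &&
  `[< exists p, isproj (closed_region C J S) x p /\ face_dim C J p = k >].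

(** For C empty and J the set of all walls this is the generic value of phi_k;
    other C and J serve the induction. *)
Definition region_count k C J x : nat :=
  (\sum_(S in powerset J) counted k C J S x)%N.

Lemma countedE k C J S x p : open_region C J S !=set0 ->
  isproj (closed_region C J S) x p ->
  counted k C J S x = (face_dim C J p == k).
Proof.
move=> nS xp; rewrite /counted asboolT //=; apply/asboolP/eqP =>
  [[q [xq <-]]|pk].
  by rewrite (isproj_uniq xp xq).
by exists p.
Qed.

Lemma counted0 k C J S x :
  ~ (open_region C J S !=set0) -> counted k C J S x = false.
Proof. by move=> nS; rewrite /counted asboolF. Qed.

Lemma isproj_orth C J S x p : isproj (closed_region C J S) x p ->
  forall v, v \in dir (C :|: active_walls J p)%SET -> dotv (x - p) v = 0.
Proof.
move=> [Sp le_p].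
have le0 v : v \in dir (C :|: active_walls J p)%SET -> dotv (x - p) v <= 0.
  move=> vA; have [e e0 /le_p] := closed_region_step Sp vA.
  by rewrite addrAC subrr add0r dotvZr pmulr_rle0.
move=> v vA; apply/eqP; rewrite eq_le le0 //= -oppr_le0 -dotvNr le0 //.
by rewrite rpredN.
Qed.

Lemma dir_setU1_id A j p : flatc A p ->
  (forall y, flatc A y -> wall_form j y = 0) -> dir (j |: A)%SET = dir A.
Proof.
move=> Ap jA; apply/vspaceP => v; apply/dirP/dirP => vA i iA.
  by apply: vA; rewrite inE iA orbT.
have /finset.setU1P[->|] := iA; last exact: vA.
have := jA _ (flatc_line 1 Ap (_ : v \in dir A)).
by rewrite wall_form_line (jA _ Ap) add0r mul1r; apply; apply/dirP.
Qed.

(** A new wall through the nearest point p contains, for generic x, the whole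
    flat spanned by the face of p; so the wall does not change the dimension
    of that face. *)
Lemma face_dim_generic C J S j x p : generic x ->
  isproj (closed_region C J S) x p ->
  face_dim C (j |: J) p = face_dim C J p.
Proof.
move=> gx xp; rewrite /face_dim; have [Cp Sp] := xp.1.
have [jp|jp] := eqVneq (wall_form j p) 0; last first.
  congr (\dim (dir (C :|: _)))%SET; apply/setP => i; rewrite !inE.
  by case: eqVneq => //= ->; rewrite (negPf jp) !andbF.
have flatp : flatc (C :|: active_walls J p)%SET p by apply/flatcU; split=> //;
  apply: flatc_active_walls.
have jA := gx _ j p flatp (isproj_orth xp) jp.
rewrite -(dir_setU1_id flatp jA); congr (\dim (dir _)).
apply/setP => i; rewrite !inE.
by case: eqVneq => //= ->; rewrite jp eqxx orbT.
Qed.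

Lemma face_dim_restrict C J j q : wall_form j q = 0 ->
  face_dim C (j |: J)%SET q = face_dim (j |: C)%SET J q.
Proof.
move=> jq; congr (\dim (dir _)); apply/setP => i; rewrite !inE.
by case: eqVneq => //= ->; rewrite jq eqxx orbT.
Qed.

(** A region that meets a wall not containing its flat has points on both
    strict sides of that wall. *)
Lemma open_region_cut C J S T j y z :
  open_region C J S z -> wall_form j z = 0 ->
  flatc C y -> wall_form j y != 0 -> {in J, forall i, (i \in T) = (i \in S)} ->
  open_region C (j |: J)%SET T !=set0.
Proof.
move=> Sz jz Cy jy TS; rewrite open_regionU1 (open_region_agree _ _ _ TS).
have vC : y - z \in dir C by case: Sz => Cz _; apply: flatc_dir Cy Cz.
have jv : dotv (u j) (y - z) = wall_form j y.
  by rewrite (dotv_wall_formB u c) jz subr0.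
(* The sign that directs the step from z to the side of j prescribed by T. *)
pose s : R := if (j \in T) == (0 < wall_form j y) then 1 else -1.
have svC : s *: (y - z) \in dir C by apply: memvZ.
have [e e0 Se] := open_region_step Sz svC.
eexists; split; first exact: Se.
have jz0 : side T j z = 0 by apply/eqP; rewrite side_eq0 jz.
rewrite /= side_line jz0 add0r mulr_gt0 // dotvZr jv /s.
have [jy0|jy0|jy0] := ltgtP 0 (wall_form j y); last by rewrite -jy0 eqxx in jy.
  by case: (j \in T); rewrite /=; lra.
by case: (j \in T); rewrite /=; lra.
Qed.

(** A region that avoids a wall lies, together with its closure, on one side of
    it. *)
Lemma closed_region_one_side C J S T j o :
  open_region C J S o -> 0 < side T j o ->
  ~ (open_region (j |: C)%SET J S !=set0) ->
  forall y, closed_region C J S y -> 0 <= side T j y.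
Proof.
move=> So jo no y Sy; rewrite leNgt; apply/negP => jy; apply: no.
have D0 : 0 < side T j o - side T j y by lra.
exists (y + (- side T j y / (side T j o - side T j y)) *: (o - y)).
apply/open_region_restrict; split.
  by apply: open_region_segment => //; rewrite divr_gt0 ?ler_pdivrMr //=; lra.
by apply/eqP; rewrite -(side_eq0 _ _ T) side_affine divfK ?subrr // lt0r_neq0.
Qed.

(** The regions T1 and T2 are the two sides of the region S with respect to the
    wall j, and T1 contains the point p of S nearest to x. If the wall cuts S,
    then p counts for T1, and the nearest point q of the slice counts for T2;
    if not, one of the two sides is all of S. *)
Lemma counted_cut k C J S T1 T2 j x p o y : generic x ->
  {in J, forall i, (i \in T1) = (i \in S)} ->
  {in J, forall i, (i \in T2) = (i \in S)} ->
  (j \in T1) = (j \notin T2) ->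
  flatc C y -> wall_form j y != 0 ->
  open_region C J S o -> isproj (closed_region C J S) x p -> 0 <= side T1 j p ->
  (counted k C (j |: J) T1 x + counted k C (j |: J) T2 x =
   counted k C J S x + counted k (j |: C) J S x)%N.
Proof.
move=> gx TS1 TS2 jT Cy jy So xp jp.
have nS : open_region C J S !=set0 by exists o.
have cls1 : closed_region C (j |: J)%SET T1 =
  closed_region C J S `&` [set z | 0 <= side T1 j z].
  by rewrite closed_regionU1 (closed_region_agree _ _ _ TS1).
have cls2 : closed_region C (j |: J)%SET T2 =
  closed_region C J S `&` [set z | side T1 j z <= 0].
  rewrite closed_regionU1 (closed_region_agree _ _ _ TS2); congr (_ `&` _);
    apply/seteqP.
  by split=> z /=; rewrite (side_opp _ _ _ jT) oppr_le0.
have opn2 : open_region C (j |: J)%SET T2 =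
  open_region C J S `&` [set z | side T1 j z < 0].
  rewrite open_regionU1 (open_region_agree _ _ _ TS2); congr (_ `&` _);
    apply/seteqP.
  by split=> z /=; rewrite (side_opp _ _ _ jT) oppr_lt0.
have xp1 : isproj (closed_region C (j |: J)%SET T1) x p.
  by rewrite cls1; apply: (isproj_sub xp) => [? []//|]; split=> //; case: xp.
rewrite (countedE _ nS xp) -(face_dim_generic j gx xp).
have [[z Sz]|no] := pselect (open_region (j |: C)%SET J S !=set0).
  have [Sz' jz] := iffLR (open_region_restrict _ _ _ _ _ _ _) Sz.
  have [|q xq] := @isproj_exists _ _ _ u c (j |: C)%SET J S x.
    by exists z; apply: open_regionW.
  rewrite (countedE k _ xp1); last exact: open_region_cut Sz' jz Cy jy TS1.
  rewrite (countedE k _ xq); last by exists z.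
  rewrite -face_dim_restrict; last first.
    by have [/flatcU1[]] := xq.1.
  congr addn; congr nat_of_bool; apply: countedE.
    exact: open_region_cut Sz' jz Cy jy TS2.
  rewrite cls2; apply: (isproj_cut _ _ xp jp).
  - by move=> *; apply: closed_region_segment.
  - by move=> *; rewrite side_affine.
  - by rewrite -closed_region_restrict.
rewrite (counted0 _ _ no) addn0.
have jo0 : side T1 j o != 0.
  by rewrite side_eq0; apply/eqP => jo; apply: no; exists o;
    apply/open_region_restrict.
have [jo|jo|/esym/eqP] := ltgtP 0 (side T1 j o); last by rewrite (negPf jo0).
  have pos := closed_region_one_side So jo no.
  rewrite (countedE k _ xp1); last first.
    by exists o; rewrite open_regionU1 (open_region_agree _ _ _ TS1); split.
  rewrite counted0 ?addn0 // opn2 => -[z [/open_regionW/pos + /=]].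
  by move=> z1 z2; lra.
have jo2 : 0 < side T2 j o.
  by rewrite (@side_opp _ _ _ _ _ T2 T1) ?oppr_gt0 // jT negbK.
have pos := closed_region_one_side So jo2 no.
have neg z : closed_region C J S z -> side T1 j z <= 0.
  by move=> /pos; rewrite (side_opp _ _ _ jT) oppr_le0.
rewrite counted0 ?add0n; last first.
  rewrite open_regionU1 (open_region_agree _ _ _ TS1) =>
    -[z [/open_regionW/neg + /=]].
  by move=> z1 z2; lra.
congr nat_of_bool; apply: countedE; first by exists o; rewrite opn2; split.
by rewrite cls2; apply: (isproj_sub xp) => [? []//|]; split;
  [case: xp|apply: neg; case: xp].
Qed.

(** Deletion and restriction hold region by region: a region S of J accounts
    for its two sides among the regions of j |: J and for its slice by the
    wall j. *)
Lemma region_count_setU1 k C J j x y : generic x -> j \notin J ->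
  flatc C y -> wall_form j y != 0 ->
  (region_count k C (j |: J) x =
   region_count k C J x + region_count k (j |: C) J x)%N.
Proof.
move=> gx jJ Cy jy; rewrite /region_count sum_powersetU1 // -big_split /=.
apply: eq_bigr => S; rewrite powersetE => /fintype.subsetP SJ.
have jS : j \notin S by apply: contra jJ; apply: SJ.
have SU : {in J, forall i, (i \in (j |: S)%SET) = (i \in S)}.
  by move=> i iJ; rewrite !inE; case: eqVneq iJ jJ => // -> ->.
have [[ o So]|nS] := pselect (open_region C J S !=set0); last first.
  rewrite !counted0 // => -[z].
  - by move/open_region_restrict => -[Sz _]; apply: nS; exists z.
  - by rewrite open_regionU1 (open_region_agree _ _ _ SU) => -[Sz _];
    apply: nS; exists z.
  - by rewrite open_regionU1 => -[Sz _]; apply: nS; exists z.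
have [|p xp] := @isproj_exists _ _ _ u c C J S x.
  by exists o; apply: open_regionW.
have [jp|jp] := leP 0 (side S j p).
  apply: (counted_cut _ gx _ SU _ Cy jy So xp) => //.
  by rewrite !inE eqxx (negPf jS).
rewrite [LHS]addnC; apply: (counted_cut _ gx SU _ _ Cy jy So xp) => //;
  first by rewrite !inE eqxx jS.
by rewrite (@side_opp _ _ _ _ _ _ S) ?oppr_ge0 ?ltW // !inE eqxx jS.
Qed.

Lemma region_count_degenerate k C J j x :
  (forall y, flatc C y -> wall_form j y = 0) ->
  region_count k C (j |: J) x = 0%N.
Proof.
move=> jC; rewrite /region_count big1 // => S _; rewrite counted0 //.
rewrite open_regionU1 => -[z [[/jC jz _] /=]].
by have /eqP := jz; rewrite -(side_eq0 _ _ S) => /eqP ->; rewrite ltxx.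
Qed.

(** In the restriction to the flat of C only the walls in B contribute to the
    sign, while the flat is that of A, the union of C and B. *)
Definition whitney_term k A B : int :=
  if `[< flatc A !=set0 >] && (\dim (dir A) == k) then (-1) ^+ #|B| else 0.

Definition whitney k C J : int :=
  \sum_(B in powerset J) whitney_term k (C :|: B)%SET B.

Lemma whitney_setU1 k C J j : j \notin J ->
  whitney k C (j |: J) = whitney k C J - whitney k (j |: C) J.
Proof.
move=> jJ; rewrite /whitney sum_powersetU1 // -sumrB; apply: eq_bigr => B.
rewrite powersetE => /fintype.subsetP BJ.
have jB : j \notin B by apply: contra jJ; apply: BJ.
congr (_ + _); rewrite /whitney_term finset.setUCA finset.setUA cardsU1 jB.
by case: ifP => _; rewrite ?oppr0 // exprS mulN1r.
Qed.

Lemma region_count_empty k C J x :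
  ~ (flatc C !=set0) -> region_count k C J x = 0%N.
Proof.
move=> nC; apply: big1 => S _; rewrite counted0 // => -[y [Cy _]].
by apply: nC; exists y.
Qed.

(** When the wall j contains the flat of C, deletion and restriction have equal
    Whitney sums, and they cancel; when it misses the flat, the restriction is
    empty; otherwise restricting to j lowers the dimension by one, which turns
    the difference of Whitney sums into the sum of the region counts. *)
Lemma whitney_region_count k C J x : generic x ->
  whitney k C J = (-1) ^+ (\dim (dir C) + k) * (region_count k C J x)%:Z.
Proof.
move=> gx; elim/finset_ind: J C => [|j J jJ IH] C.
  rewrite /whitney /region_count powerset0 !big_set1 finset.setU0.
  rewrite /whitney_term cards0 expr0.
  have clsE : closed_region C finset.set0 finset.set0 = flatc C.
    by apply/seteqP; split=> [y []//|y Cy]; split=> // i; rewrite inE.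
  have opnE : open_region C finset.set0 finset.set0 = flatc C.
    by apply/seteqP; split=> [y []//|y Cy]; split=> // i; rewrite inE.
  have [nC|nC] := pselect (flatc C !=set0); last first.
    by rewrite counted0 ?opnE // asboolF ?mulr0.
  have [p xp] := isproj_flat x nC.
  rewrite (@countedE _ _ _ _ _ p) ?opnE ?clsE // asboolT //= /face_dim.
  have -> : active_walls finset.set0 p = finset.set0 by apply/setP => i;
    rewrite !inE.
  rewrite finset.setU0; case: eqVneq => [->|_]; last by rewrite mulr0.
  by rewrite addnn -signr_odd odd_double expr0 mulr1.
rewrite whitney_setU1 // !IH.
have [jC|] := pselect (forall y, flatc C y -> wall_form j y = 0).
  rewrite region_count_degenerate // mulr0 -!IH; apply/eqP.
  rewrite subr_eq0; apply/eqP/eq_bigr => B _; rewrite /whitney_term.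
  have jCB y : flatc (C :|: B)%SET y -> wall_form j y = 0.
    by move=> /flatcU[/jC].
  have -> : flatc (j |: C :|: B)%SET = flatc (C :|: B)%SET.
    apply/seteqP; rewrite -finset.setUA; split=> y; first by move=> /flatcU1[].
    by move=> By; apply/flatcU1; split=> //; apply: jCB.
  have [[y By]|nB] := pselect (flatc (C :|: B)%SET !=set0); last first.
    by rewrite asboolF.
  by rewrite -finset.setUA (dir_setU1_id By jCB).
move=> /existsNP[y /not_implyP[Cy /eqP jy]].
rewrite (region_count_setU1 _ gx jJ Cy jy).
have [[z /flatcU1[Cz jz]]|njC] := pselect (flatc (j |: C)%SET !=set0);
  last first.
  by rewrite (region_count_empty _ _ _ njC) mulr0 subr0 addn0.
rewrite (@dim_dir_setU1 _ _ _ u j C (y - z)); last 2 first.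
- exact: flatc_dir Cy Cz.
- by rewrite (dotv_wall_formB u c) jz subr0.
by rewrite addSn exprS mulN1r !mulNr PoszD mulrDr opprD.
Qed.

End Counting.

(** * Faces and normal cones of chambers *)

Section AffineDimension.
Variables (R : realType) (d : nat).

(** The affine hull of S is read off at any point p from which S can be left in
    every direction of V. *)
Lemma affdimE (S : set 'rV[R]_d) (V : {vspace 'rV[R]_d}) p : S p ->
  (forall x, S x -> x - p \in V) ->
  (forall v, v \in V -> exists2 e, 0 < e & S (p + e *: v)) ->
  affdim S = \dim V.
Proof.
move=> Sp SV VS; congr (\dim _); apply: xget_subset1.
  split=> [x y /SV xp /SV yp|W SW].
    by have := rpredB xp yp; rewrite opprB addrA subrK.
  apply/subvP => v /VS[e e0 /SW /(_ Sp)].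
  by rewrite addrAC subrr add0r rpredZeq gt_eqF.
move=> U1 U2 [U1S le1] [U2S le2]; apply/eqP; rewrite eqEsubv.
by rewrite le1 // le2.
Qed.

End AffineDimension.

Section Faces.
Variables (R : realType) (d : nat) (I : finType).
Variables (u : I -> 'rV[R]_d) (c : I -> R).
Implicit Types (A B C J S T : {set I}) (x y z p q v w f : 'rV[R]_d) (i j : I).
Local Notation dir := (dir u).
Local Notation wall_form := (wall_form u c).
Local Notation side := (side u c).
Local Notation flatc := (flatc u c).
Local Notation chamber := (open_region u c finset.set0 [set: I]%SET).
Local Notation cell := (closed_region u c finset.set0 [set: I]%SET).
Local Notation active := (active_walls u c [set: I]%SET).

Lemma activeP x i : reflect (wall_form i x = 0) (i \in active x).
Proof. by rewrite !inE; apply: eqP. Qed.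

Lemma flatc_active A x : flatc A x <-> A \subset active x.
Proof.
split=> [Ax|/fintype.subsetP Ax i /Ax /activeP//].
by apply/fintype.subsetP => i /Ax ix; apply/activeP.
Qed.

Lemma affdim_flat A p : flatc A p -> affdim (flatc A) = \dim (dir A).
Proof.
move=> Ap; apply: (affdimE Ap) => [x Ax|v vA]; first exact: flatc_dir Ax Ap.
by exists 1 => //; apply: flatc_line.
Qed.

Lemma cellP S x : cell S x <-> forall i, 0 <= side S i x.
Proof.
split=> [[_ Sx] i|Sx]; first by apply: Sx; rewrite inE.
by split=> i; rewrite inE.
Qed.

Lemma chamberP S x : chamber S x <-> forall i, 0 < side S i x.
Proof.
split=> [[_ Sx] i|Sx]; first by apply: Sx; rewrite inE.
by split=> i; rewrite inE.
Qed.

(** Every face is cut out of the cell by the walls that contain it; A is the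
    set of walls containing the face exactly when A is the set of walls through
    some point of the cell, namely a relatively interior point of the face. *)
Definition face S A := cell S `&` flatc A.
Definition face_set S A := exists2 p, cell S p & active p = A.

Lemma face_step S p v : cell S p -> v \in dir (active p) ->
  exists2 e, 0 < e & face S (active p) (p + e *: v).
Proof.
move=> Sp vA; have [|e e0 Se] := closed_region_step (v := v) Sp;
  first by rewrite finset.set0U.
exists e => //; split=> //; apply: flatc_line => //.
exact: flatc_active_walls.
Qed.

(** A linear function bounded on a cell by its value at p is constant on the
    face whose relative interior contains p. *)
Lemma max_const_on_face S p w : cell S p ->
  (forall y, face S (active p) y -> dotv w y <= dotv w p) ->
  forall y, face S (active p) y -> dotv w y = dotv w p.
Proof.
move=> Sp maxp y Fy; apply/eqP; rewrite eq_le maxp //=.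
have [e e0 /maxp] : exists2 e, 0 < e & face S (active p) (p + e *: (p - y)).
  apply: face_step => //.
  by apply: flatc_dir; [exact: flatc_active_walls|case: Fy].
by rewrite dotvDr dotvZr gerDl pmulr_rle0 // dotvBr subr_le0.
Qed.

Lemma face_set_inj S A B : face_set S A -> face_set S B ->
  face S A = face S B -> A = B.
Proof.
suff le A' B' : face_set S A' -> face S A' = face S B' -> B' \subset A'.
  by move=> SA SB AB; apply/eqP; rewrite finset.eqEsubset !le.
move=> [p Sp <-] AB; have : face S (active p) p.
  by split=> //; apply: flatc_active_walls.
by rewrite AB => -[_ /flatc_active].
Qed.

Lemma affdim_face S A : face_set S A -> affdim (face S A) = \dim (dir A).
Proof.
move=> [p Sp <-]; have Ap := @flatc_active_walls _ _ _ u c [set: I]%SET p.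
apply: (@affdimE _ _ _ _ p); first by split.
  by move=> x [_ Ax]; apply: flatc_dir Ax Ap.
by move=> v /(face_step Sp).
Qed.

(** A supporting functional attaining its maximum at p is constant on the whole
    face, so no smaller face contains p. *)
Lemma relint_face S p : cell S p -> relint (face S (active p)) p.
Proof.
move=> Sp; have Ap := @flatc_active_walls _ _ _ u c [set: I]%SET p.
split=> [|G [_ [->|[w [b [_ le_b ->]]]]]]; [by split|by rewrite ltnn|].
move=> + [_ pb]; suff -> : face S (active p) `&` [set y | dotv w y = b] =
    face S (active p) by rewrite ltnn.
apply/seteqP; split=> y [] // Sy Ay; split=> //=.
rewrite -[RHS]pb; apply: (max_const_on_face Sp) => // z Fz.
by rewrite pb le_b.
Qed.

Lemma midpoint_cell S p q : cell S p -> cell S q ->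
  cell S (p + 2^-1 *: (q - p)) /\
  active (p + 2^-1 *: (q - p)) = (active p :&: active q)%SET.
Proof.
move=> Sp Sq; split; first by apply: closed_region_segment => //; lra.
apply/setP => i; rewrite finset.in_setI; apply/activeP/andP => [i0|].
  have i0' : side S i (p + 2^-1 *: (q - p)) = 0 by apply/eqP;
    rewrite side_eq0 i0.
  have := iffLR (cellP _ _) Sp i; have := iffLR (cellP _ _) Sq i.
  rewrite side_affine in i0' => q0 p0.
  split; apply/activeP/eqP; rewrite -(side_eq0 _ _ S); apply/eqP; lra.
move=> [/activeP ip /activeP iq];
  rewrite wall_form_line ip (dotv_wall_formB u c) ip iq; lra.
Qed.

Lemma dotv_slope S i x y :
  dotv (if i \in S then u i else - u i) (x - y) = side S i x - side S i y.
Proof.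
rewrite /side; case: ifP => _; rewrite ?dotvNl (dotv_wall_formB u c) //; ring.
Qed.

(** The sum of the outer normals of the walls containing the face supports the
    cell along it; it is nonzero because the chamber has a point strictly inside
    all these walls. *)
Lemma is_face_face S A : chamber S !=set0 -> face_set S A ->
  is_face (cell S) (face S A).
Proof.
move=> [ o So] [p Sp <-].
have Ap := @flatc_active_walls _ _ _ u c [set: I]%SET p.
split; first by exists p.
have [A0|[i0 Ai0]] := set_0Vmem (active p).
  by left; rewrite A0; apply/seteqP; split=> [y []//|y Sy]; split=> // i;
    rewrite inE.
right; pose w := - \sum_(i in active p) (if i \in S then u i else - u i).
have wE y z : dotv w (y - z) = \sum_(i in active p) (side S i z - side S i y).
  rewrite dotvNl dotv_suml -sumrN; apply: eq_bigr => i _.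
  by rewrite dotv_slope opprB.
have wpE y : dotv w (y - p) = - \sum_(i in active p) side S i y.
  rewrite wE -sumrN; apply: eq_bigr => i /activeP ip.
  by have /eqP := ip; rewrite -(side_eq0 _ _ S) => /eqP ->; rewrite sub0r.
exists w, (dotv w p); split.
- apply/eqP => w0; have := wpE o; rewrite w0 dotv0l => /esym/eqP.
  rewrite oppr_eq0 psumr_eq0 => [/allP/(_ i0 (mem_index_enum _))|i _];
    last first.
    by apply: ltW; move/chamberP: So.
  by rewrite Ai0 /= gt_eqF //; move/chamberP: So.
- move=> y /cellP Sy; rewrite -subr_le0 -dotvBr wpE oppr_le0.
  exact: sumr_ge0.
apply/seteqP; split=> y [Sy yw]; split=> //=.
  apply/eqP; rewrite -subr_eq0 -dotvBr wpE oppr_eq0 big1 // => i iA.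
  by apply/eqP; rewrite side_eq0; apply/eqP/yw.
move=> i iA; apply/eqP; rewrite -(side_eq0 _ _ S).
have /eqP := yw; rewrite -subr_eq0 -dotvBr wpE oppr_eq0.
rewrite psumr_eq0 => [/allP/(_ i (mem_index_enum _))|l _];
  last by move/cellP: Sy.
by rewrite iA.
Qed.

(** Conversely a point of the face lying on as few walls as possible lies only
    on the walls that contain the face, by passing to midpoints. *)
Lemma is_faceE S F : is_face (cell S) F ->
  exists2 A, face_set S A & F = face S A.
Proof.
move=> [[p0 Fp0] faceF].
have FS : F `<=` cell S by case: faceF => [->//|[w [b [_ _ ->]]] y []].
have Fcvx y z : F y -> F z -> F (y + 2^-1 *: (z - y)).
  move=> Fy Fz; have [Sm _] := midpoint_cell (FS _ Fy) (FS _ Fz).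
  case: faceF Fy Fz => [->//|[w [b [_ _ ->]]]] [_ /= yb] [_ /= zb]; split=> //=.
  by rewrite dotvDr dotvZr dotvBr yb zb subrr mulr0 addr0.
have exF : exists n, `[< exists2 y, F y & #|active y| = n >].
  by exists #|active p0|; apply/asboolP; exists p0.
have [n /asboolP[p Fp pn] nmin] := ex_minnP exF.
have Sp := FS _ Fp.
(* The midpoint of p and y lies only on the walls common to both. *)
have Fact y : F y -> flatc (active p) y.
  move=> Fy; apply/flatc_active.
  have := nmin _ (asboolT (ex_intro2 _ _ _ (Fcvx _ _ Fp Fy) erefl)).
  have [_ ->] := midpoint_cell Sp (FS _ Fy); rewrite -pn => le_n.
  apply/finset.setIidPl/eqP; rewrite eqEcard le_n andbT.
  exact: finset.subsetIl.
exists (active p); first by exists p.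
apply/seteqP; split=> y; first by move=> Fy; split; [apply: FS|apply: Fact].
case: faceF => [->[]//|[w [b [_ le_b Fw]]]] Ay.
rewrite Fw; split; first by case: Ay.
have pb : dotv w p = b by move: Fp; rewrite Fw => -[].
rewrite /= -pb; apply: (max_const_on_face Sp) => // z [Sz _].
by rewrite pb le_b.
Qed.

(** Feasible directions at any relatively interior point f of the face give the
    same constraints as those at p, because z is constant on the face. *)
Lemma normal_coneE S p z : cell S p ->
  normal_cone (cell S) (face S (active p)) z <->
  forall y, cell S y -> dotv z (y - p) <= 0.
Proof.
move=> Sp; have Ap := @flatc_active_walls _ _ _ u c [set: I]%SET p.
split=> [zN y Sy|le_z v [f [[Sf Af] _] [e e0 Se]]].
  apply: zN; exists p; first exact: relint_face.
  by exists 1 => //; rewrite scale1r addrC subrK.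
have zf : dotv z f = dotv z p.
  apply: (max_const_on_face Sp) => [y [Sy _]|]; last by split.
  by rewrite -subr_le0 -dotvBr le_z.
have := le_z _ Se; rewrite dotvBr dotvDr zf addrAC subrr add0r dotvZr.
by rewrite pmulr_rle0.
Qed.

(** The last condition says that the vector x - q attains its maximum over the
    cell on the whole face and not only at q. *)
Lemma face_plus_normalE S p x : cell S p ->
  face_plus_normal (cell S) (face S (active p)) x <->
  exists q, [/\ isproj (cell S) x q, flatc (active p) q &
                forall y, cell S y -> dotv (x - q) (y - p) <= 0].
Proof.
move=> Sp; split=> [[f [Sf Af]] [z /(normal_coneE _ Sp) zN <-]|].
  exists f; rewrite [f + z]addrC addrK; split=> //; split=> // y Sy.
  have zf : dotv z f = dotv z p.
    apply: (max_const_on_face Sp) => [w [Sw _]|]; last by split.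
    by rewrite -subr_le0 -dotvBr zN.
  by rewrite addrK dotvBr zf -dotvBr zN.
move=> [q [[Sq le_q] Aq le_p]]; exists q; first by split.
by exists (x - q); [apply/(normal_coneE _ Sp)|rewrite addrC subrK].
Qed.

(** For generic x, the point p of the cell nearest to x determines the only
    face F with x in F + N_F(P): the one with p in its relative interior. *)
Lemma face_plus_normal_generic S A x p : generic u c x ->
  isproj (cell S) x p -> face_set S A ->
  face_plus_normal (cell S) (face S A) x <-> A = active p.
Proof.
move=> gx xp [f Sf <-]; split=> [|->]; last first.
  have [Sp le_p] := xp; apply/(face_plus_normalE _ Sp).
  by exists p; split=> //; apply: flatc_active_walls.
move=> /(face_plus_normalE _ Sf).
move=> [q [xq Aq le_f]]; rewrite (isproj_uniq xp xq) {xp}.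
apply/eqP; rewrite finset.eqEsubset; apply/andP; split;
  first exact/flatc_active.
apply/fintype.subsetP => j /activeP jq; apply/activeP.
apply: (gx (active f) j q Aq _ jq); last exact: flatc_active_walls.
have le0 v : v \in dir (active f) -> dotv (x - q) v <= 0.
  move=> /(face_step Sf)[e e0 [/le_f]].
  by rewrite addrAC subrr add0r dotvZr pmulr_rle0.
move=> v vA; apply/eqP; rewrite eq_le le0 //= -oppr_le0 -dotvNr le0 //.
by rewrite rpredN.
Qed.

End Faces.

(** * Topology of chambers and of the sets F + N_F(P) *)

Section EuclideanTopology.
Variables (R : realType) (d : nat).
Implicit Types (x y v w : 'rV[R]_d).

Lemma dotv_continuous v : continuous (fun w => dotv v w).
Proof.
apply: continuous_big => [|i _]; first exact: (@add_continuous R^o).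
move=> w; apply: (@cvgM R _ (nbhs w) _ (fun=> v 0 i) (fun z => z 0 i)).
  exact: cvg_cst.
exact: coord_continuous.
Qed.

Lemma sqdist_continuous x : continuous (fun w => dotv (x - w) (x - w)).
Proof.
apply: continuous_big => [|i _]; first exact: (@add_continuous R^o).
have c_i : continuous (fun w => (x - w) 0 i).
  have -> : (fun w => (x - w) 0 i) = (fun w => x 0 i - w 0 i).
    by apply/funext => w; rewrite !mxE.
  move=> w; apply: (@cvgB _ R^o _ (nbhs w) _ (fun=> x 0 i) (fun z => z 0 i)).
    exact: cvg_cst.
  exact: coord_continuous.
move=> w; apply: (@cvgM R _ (nbhs w) _ (fun z => (x - z) 0 i)
  (fun z => (x - z) 0 i)); exact: (c_i w).
Qed.

Lemma line_continuous x v : continuous (fun t : R => x + t *: v).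
Proof.
by move=> t; apply: cvgD; [exact: cvg_cst|exact: scalel_continuous].
Qed.

Lemma nbhs_line x v (B : set 'rV[R]_d) : nbhs x B ->
  exists t : R, 0 < t <= 1 /\ B (x + t *: v).
Proof.
move=> xB.
have B0 : nbhs (x + 0 *: v) B by rewrite scale0r addr0.
have [t [[t0 t1] Bt]] : exists t : R, (0 < t /\ t < 1) /\ B (x + t *: v).
  apply: (@filter_ex _ (0:R)^'+); near=> t; split; first split.
  - by near: t; exact: nbhs_right_gt.
  - by near: t; exact: nbhs_right_lt.
  - near: t; exact: (cvg_at_right_filter (@line_continuous x v 0) B0).
by exists t; rewrite t0 ltW.
Unshelve. all: by end_near. Qed.

Lemma hyperplaneC_dense w b : w != 0 -> dense (~` [set x | dotv w x = b]).
Proof.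
move=> w0 O [x Ox] oO.
have [xb|xb] := eqVneq (dotv w x) b; last by exists x; split=> //; apply/eqP.
have [t [/andP[t0 _] Ot]] := nbhs_line w (open_nbhs_nbhs (conj oO Ox)).
exists (x + t *: w); split=> //=; rewrite dotvDr dotvZr xb => /eqP.
rewrite -subr_eq0 addrAC subrr add0r mulf_eq0 gt_eqF //= => /eqP /dotv_eq0.
by move/eqP: w0.
Qed.

Lemma hyperplaneC_open w b : open (~` [set x | dotv w x = b]).
Proof.
have -> : ~` [set x | dotv w x = b] = (fun x => dotv w x) @^-1` (~` [set b]).
  by [].
apply: open_comp => [x _|]; first exact: dotv_continuous.
by apply: closed_openC; apply: closed_eq.
Qed.

Lemma convex_connected (K : set 'rV[R]_d) :
  (forall y z t, K y -> K z -> 0 <= t <= 1 -> K (y + t *: (z - y))) ->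
  connected K.
Proof.
move=> cvxK; have [[x Kx]|K0] := pselect (K !=set0); last first.
  have -> : K = set0 by apply/seteqP; split=> // y Ky; apply: K0; exists y.
  exact: connected0.
have -> : K = \bigcup_(z in K) ((fun t : R => x + t *: (z - x)) @` `[0, 1]).
  apply/seteqP; split=> [z Kz|y [z Kz [t /= t01 <-]]].
    exists z => //; exists 1; first by rewrite /= in_itv /= ler01 lexx.
    by rewrite scale1r addrC subrK.
  by apply: cvxK => //; move: t01; rewrite in_itv.
apply: bigcup_connected => [|z Kz].
  exists x => z Kz; exists 0; first by rewrite /= in_itv /= ler01 lexx.
  by rewrite scale0r addr0.
apply: connected_continuous_connected; first exact: segment_connected.
exact/continuous_subspaceT/line_continuous.
Qed.

End EuclideanTopology.

Lemma dense_bigI (T : topologicalType) (I : finType) (G : I -> set T) :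
  (forall i, open (G i)) -> (forall i, dense (G i)) ->
  dense [set x | forall i, G i x].
Proof.
move=> oG dG.
suff [_ dE] : open [set x | forall i, i \in enum I -> G i x] /\
              dense [set x | forall i, i \in enum I -> G i x].
  have -> : [set x | forall i, G i x] =
      [set x | forall i, i \in enum I -> G i x].
    by apply/seteqP; split=> x Gx i; [move=> _|]; apply: Gx; rewrite ?mem_enum.
  by [].
elim: (enum I) => [|i s [oE dE]].
  have -> : [set x | forall i, i \in [::] -> G i x] = setT.
    by apply/seteqP; split.
  by split; [exact: openT|move=> O [x Ox] _; exists x].
have -> : [set x | forall l, l \in i :: s -> G l x] =
    G i `&` [set x | forall l, l \in s -> G l x].
  apply/seteqP; split=> x; last by move=> [Gx Gs] l; rewrite inE =>
    /orP[/eqP->|/Gs].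
  move=> Gx; split; first by apply: Gx; rewrite inE eqxx.
  by move=> l ls; apply: Gx; rewrite inE ls orbT.
by split; [exact: openI|exact: denseI].
Qed.

Section ArrangementTopology.
Variables (R : realType) (d : nat) (I : finType).
Variables (u : I -> 'rV[R]_d) (c : I -> R).
Implicit Types (A B C J S T : {set I}) (x y z p q v w f : 'rV[R]_d) (i j : I).
Local Notation dir := (dir u).
Local Notation wall_form := (wall_form u c).
Local Notation side := (side u c).
Local Notation flatc := (flatc u c).
Local Notation chamber := (open_region u c finset.set0 [set: I]%SET).
Local Notation cell := (closed_region u c finset.set0 [set: I]%SET).
Local Notation active := (active_walls u c [set: I]%SET).
Local Notation face := (face u c).
Local Notation face_set := (face_set u c).

Lemma wall_form_continuous i : continuous (fun x => wall_form i x).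
Proof.
move=> x; apply: (@cvgB _ R^o _ (nbhs x) _ (dotv (u i)) (fun=> c i)).
  exact: dotv_continuous.
exact: cvg_cst.
Qed.

Lemma side_continuous S i : continuous (fun x => side S i x).
Proof.
move=> x; rewrite /side; case: (i \in S); first exact: wall_form_continuous.
by apply: (@cvgN _ R^o _ (nbhs x) _ (wall_form i)); exact: wall_form_continuous.
Qed.

Lemma chamber_connected S : connected (chamber S).
Proof.
apply: convex_connected => y z t Sy Sz /andP[t0 t1].
have [->|tN] := eqVneq t 0; first by rewrite scale0r addr0.
by apply: open_region_segment => //;
  [exact: open_regionW|rewrite lt_neqAle eq_sym tN t0].
Qed.

(** A chamber is convex, hence connected; and a connected set avoiding all walls
    cannot change sides, as its image under each affine form is an interval
    without 0. *)
Lemma component_chamber S x : chamber S x ->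
  connected_component [set y | forall i, wall_form i y != 0] x = chamber S.
Proof.
move=> Sx; apply/seteqP; split; last first.
  apply: connected_component_max => //; last exact: chamber_connected.
  by move=> y /chamberP Sy i; rewrite -(side_eq0 _ _ S) gt_eqF.
move=> y Cy; apply/chamberP => i; rewrite ltNge; apply/negP => yi.
have := @component_connected _ [set y | forall i, wall_form i y != 0] x.
set K := connected_component _ _ => Kconn.
have imK : is_interval (side S i @` K).
  apply/connected_intervalP; apply: connected_continuous_connected => //.
  exact/continuous_subspaceT/side_continuous.
have Kx : K x.
  apply: connected_component_refl => l; move/chamberP: Sx => Sx.
  by rewrite -(side_eq0 _ _ S) gt_eqF.
have y0x : side S i y <= 0 <= side S i x.
  by rewrite yi ltW //; move/chamberP: Sx.
have [z Kz z0] := imK _ _ (imageP _ Cy) (imageP _ Kx) 0 y0x.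
have := connected_component_sub Kz i.
by rewrite -(side_eq0 _ _ S) z0 eqxx.
Qed.

Lemma closure_chamber S : chamber S !=set0 -> closure (chamber S) = cell S.
Proof.
move=> [ o So]; apply/seteqP; split=> q.
  move=> clq; apply/cellP => i; rewrite leNgt; apply/negP => qi.
  have [y [/chamberP Sy /=]] := clq _ (cvgr_lt _ (@side_continuous S i q) _ qi).
  by rewrite ltNge ltW // Sy.
move=> Sq B /(nbhs_line (o - q))[t [t01 Bt]].
by exists (q + t *: (o - q)); split=> //; apply: open_region_segment.
Qed.

Lemma cell_inj S T : chamber S !=set0 -> cell S = cell T -> S = T.
Proof.
move=> [x /chamberP Sx] ST; apply/setP => i.
have : cell T x by rewrite -ST; apply/cellP => l; apply: ltW.
move/cellP => /(_ i); have := Sx i; rewrite /side.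
by case: (i \in S); case: (i \in T) => //; lra.
Qed.

(** A nongeneric x lies on one of finitely many hyperplanes. The one attached
    to the flat of B and the wall j has as normal vector the projection w of
    u j onto the direction space of the flat. *)
Lemma generic_dense : dense (generic u c).
Proof.
have nongeneric (Bj : {set I} * I) : exists G : set 'rV[R]_d,
    [/\ open G, dense G & forall x, G x -> forall p, flatc Bj.1 p ->
      (forall v, v \in dir Bj.1 -> dotv (x - p) v = 0) ->
      wall_form Bj.2 p = 0 -> forall y, flatc Bj.1 y -> wall_form Bj.2 y = 0].
  case: Bj => B j /=; have [w [wB wP]] := dir_proj u B (u j).
  have const p q : flatc B p -> flatc B q ->
      dotv (u j - w) p = dotv (u j - w) q.
    by move=> Bp Bq; apply/eqP; rewrite -subr_eq0 -dotvBr wP //;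
      apply: flatc_dir Bp Bq.
  have [[p0 Bp0]|nB] := pselect (flatc B !=set0); last first.
    exists setT; split; [exact: openT|by move=> O [x Ox] _; exists x|].
    by move=> x _ p Bp; case: nB; exists p.
  have [w0|w0] := eqVneq w 0.
    exists setT; split; [exact: openT|by move=> O [x Ox] _; exists x|].
    move=> x _ p Bp _ jp y By; rewrite -jp; congr (_ - _).
    by have := const _ _ By Bp; rewrite w0 subr0.
  (* If p is the projection of x and lies on the wall j, then x has the same
     product with w as p, and u j - w is constant on the flat. *)
  exists (~` [set x | dotv w x = c j - dotv (u j - w) p0]); split.
  - exact: hyperplaneC_open.
  - exact: hyperplaneC_dense.
  move=> x + p Bp xp jp => /(_ _)/=; case.
  have := xp w wB; rewrite dotvC dotvBr => /eqP; rewrite subr_eq0 => /eqP ->.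
  have := const _ _ Bp Bp0; rewrite !dotvBl.
  by move: jp; rewrite /wall_form; lra.
have [G GP] := choice nongeneric.
have := @dense_bigI _ _ G (fun Bj => let: And3 oG _ _ := GP Bj in oG)
                          (fun Bj => let: And3 _ dG _ := GP Bj in dG).
move=> dG O O0 oO; have [x [Ox Gx]] := dG O O0 oO; exists x;
  split=> // B j p Bp.
by have [_ _ /(_ x (Gx _)) xP] := GP (B, j); apply: xP.
Qed.

Lemma sqr_small_eq0 (K s : R) : 0 <= K ->
  (forall e, 0 < e -> s ^+ 2 <= K * e) -> s = 0.
Proof.
move=> K0 sK; apply/eqP; rewrite -sqrf_eq0 eq_le sqr_ge0 andbT leNgt.
apply/negP => s0; have K1 : 0 < K + 1 by lra.
have := sK (s ^+ 2 / (K + 1)) (divr_gt0 s0 K1); apply/negP; rewrite -ltNge.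
by rewrite mulrA ltr_pdivrMr //; nra.
Qed.

(** The nearest point depends on x in a 1-Lipschitz way, and membership in
    F + N_F(P) is a closed condition on x and its nearest point. *)
Lemma face_plus_normal_closed S A : face_set S A ->
  closed (face_plus_normal (cell S) (face S A)).
Proof.
move=> [f Sf <-] x clx; apply/face_plus_normalE => //.
have [|p xp] := @isproj_exists _ _ _ u c finset.set0 [set: I]%SET S x.
  by exists f.
have approx e : 0 < e -> exists x' q,
    [/\ isproj (cell S) x' q, flatc (active f) q,
        forall y, cell S y -> dotv (x' - q) (y - f) <= 0,
        dotv (x - x') (x - x') <= e & dotv (p - q) (p - q) <= e].
  move=> e0; have xx : dotv (x - x) (x - x) < e by rewrite subrr dotv0l.
  have [x' [Fx' /= xx']] := clx _ (cvgr_lt _ (@sqdist_continuous _ _ x x) _ xx).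
  have [q [x'q Aq le_q]] := iffLR (face_plus_normalE _ Sf) Fx'.
  exists x', q; split=> //; first exact: ltW.
  have := isproj_le xp x'q; have := dotv_Cauchy_Schwarz (x - x') (p - q).
  have := dotv_ge0 (p - q); have := dotv_ge0 (x - x').
  set a := dotv (x - x') (x - x'); set b := dotv (p - q) (p - q).
  set s := dotv _ _ => a0 b0 sab bs.
  have bb : b * b <= a * b by apply: le_trans sab; rewrite expr2 ler_pM.
  have [->|bN] := eqVneq b 0; first exact: ltW.
  have {}b0 : 0 < b by rewrite lt_neqAle eq_sym bN.
  by rewrite ler_pM2r // in bb; apply: le_trans bb (ltW _).
exists p; split=> //.
  move=> i iA; apply: (sqr_small_eq0 (dotv_ge0 (u i))) => e e0.
  have [x' [q [_ Aq _ _ pq]]] := approx e e0.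
  have -> : wall_form i p = dotv (u i) (p - q).
    by rewrite (dotv_wall_formB u c) Aq // subr0.
  apply: le_trans (dotv_Cauchy_Schwarz _ _) _.
  by rewrite ler_wpM2l ?dotv_ge0.
move=> y Sy; rewrite leNgt; apply/negP => s0; have := s0.
rewrite (@sqr_small_eq0 (4 * dotv (y - f) (y - f)) (dotv (x - p) (y - f)))
  ?ltxx //.
  by rewrite mulr_ge0 // dotv_ge0.
move=> e e0; have [x' [q [_ _ le_q xx' pq]]] := approx e e0.
have := le_q y Sy.
have -> : dotv (x' - q) (y - f) =
    dotv (x - p) (y - f) - dotv (x - x') (y - f) + dotv (p - q) (y - f).
  by rewrite !dotvBl; ring.
have := dotv_Cauchy_Schwarz (x - x') (y - f).
have := dotv_Cauchy_Schwarz (p - q) (y - f).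
move: s0; have := dotv_ge0 (y - f).
set Y := dotv (y - f) (y - f); set s := dotv (x - p) (y - f).
set s1 := dotv (x - x') (y - f); set s2 := dotv (p - q) (y - f).
move: xx' pq; set X := dotv (x - x') (x - x'); set Q := dotv (p - q) (p - q).
move=> Xe Qe Y0 s0 sQ sX le_s.
have sQ' : s2 ^+ 2 <= Y * e by apply: le_trans sQ _; rewrite mulrC ler_wpM2l.
have sX' : s1 ^+ 2 <= Y * e by apply: le_trans sX _; rewrite mulrC ler_wpM2l.
have ss : s <= s1 - s2 by lra.
have s2s : s ^+ 2 <= (s1 - s2) ^+ 2.
  by rewrite ler_pXn2r // nnegrE ?ltW // (lt_le_trans s0).
have : 0 <= (s1 + s2) ^+ 2 by apply: sqr_ge0.
by rewrite sqrrB sqrrD in s2s *; lra.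
Qed.

End ArrangementTopology.

(** * The function phi and the characteristic polynomial *)

Lemma fsbig_fin (V : nmodType) (T : finType) (P : set T) (F : T -> V) :
  \sum_(i \in P) F i = \sum_(i | `[< P i >]) F i.
Proof.
pose r := [seq i <- enum T | `[< P i >]].
have Pr : P = [set` r].
  apply/seteqP; split=> i /=; rewrite mem_filter mem_enum andbT.
    by move=> Pi; apply/asboolP.
  by move/asboolP.
have ur : uniq r by rewrite filter_uniq // enum_uniq.
by rewrite [in LHS]Pr -fsbig_seq // big_filter big_enum_cond.
Qed.

Section Arrangement.
Variables (R : realType) (d m : nat) (u : 'I_m -> 'rV[R]_d) (c : 'I_m -> R).
Implicit Types (A B S T : {set 'I_m}) (x y p : 'rV[R]_d) (k : nat).
Local Notation dir := (dir u).
Local Notation wall_form := (wall_form u c).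
Local Notation flatc := (flatc u c).
Local Notation chamber := (open_region u c finset.set0 [set: 'I_m]%SET).
Local Notation cell := (closed_region u c finset.set0 [set: 'I_m]%SET).
Local Notation active := (active_walls u c [set: 'I_m]%SET).
Local Notation face := (face u c).
Local Notation face_set := (face_set u c).

Definition wall (i : 'I_m) : set 'rV[R]_d := [set x | dotv (u i) x = c i].

Lemma wallE i x : wall i x <-> wall_form i x = 0.
Proof.
by rewrite /wall /wall_form /=; split=> [->|/eqP];
  rewrite ?subrr // subr_eq0 => /eqP.
Qed.

Lemma flat_wall B : flat wall B = flatc B.
Proof. by apply/seteqP; split=> x Bx i iB; apply/wallE/Bx. Qed.

Lemma arr_complementE :
  arr_complement wall = [set x | forall i, wall_form i x != 0].
Proof.
apply/seteqP; split=> x.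
  by move=> nx i; apply/eqP => /wallE ix; apply: nx; exists i.
by move=> nx [i _ /wallE /eqP]; apply/negP.
Qed.

Lemma chambersE : chambers wall = cell @` [set S | chamber S !=set0].
Proof.
rewrite /chambers arr_complementE; apply/seteqP; split=> P [].
  move=> x x0 <-; pose S := [set i | 0 < wall_form i x]%SET.
  have Sx : chamber S x.
    apply/chamberP => i; rewrite /side inE.
    case: (ltP 0 (wall_form i x)) => //= xi.
    by rewrite oppr_gt0 lt_neqAle xi x0.
  exists S; first by exists x.
  by rewrite (component_chamber Sx) closure_chamber //; exists x.
move=> S [x Sx] <-; exists x.
  by move=> i; move/chamberP: Sx => /(_ i); rewrite -(side_eq0 _ _ S) =>
    /gt_eqF ->.
by rewrite (component_chamber Sx) closure_chamber //; exists x.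
Qed.

Definition face_sets k S := [set A | face_set S A /\ \dim (dir A) = k].

Lemma facesE k S :
  chamber S !=set0 -> faces k (cell S) = face S @` face_sets k S.
Proof.
move=> nS; apply/seteqP; split=> F.
  by move=> [/is_faceE[A SA ->] dF]; exists A => //; split;
    rewrite -?(affdim_face SA).
by move=> [A [SA dA] <-]; split; [apply: is_face_face|rewrite affdim_face].
Qed.

Lemma phiE k x : phi wall k x =
  \sum_(S : {set 'I_m} | `[< chamber S !=set0 >])
    \sum_(A : {set 'I_m} | `[< face_sets k S A >])
      (\1_(face_plus_normal (cell S) (face S A)) x : int).
Proof.
rewrite /phi chambersE fsbig_image; last first.
  by move=> S T; rewrite !inE => nS _; apply: cell_inj.
rewrite fsbig_fin; apply: eq_bigr => S /asboolP nS.
rewrite facesE // fsbig_image ?fsbig_fin //.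
by move=> A B; rewrite !inE => -[SA _] [SB _]; apply: face_set_inj.
Qed.

(** Each chamber contributes the indicator of the event that its nearest point
    lies in the relative interior of a k-face. *)
Lemma phi_generic k x : generic u c x ->
  phi wall k x = (region_count u c k finset.set0 [set: 'I_m]%SET x)%:Z.
Proof.
move=> gx; rewrite phiE /region_count.
rewrite (big_morph Posz PoszD erefl) big_mkcond /=.
rewrite [RHS](eq_bigl predT) => [|S]; last by rewrite powersetE finset.subsetT.
apply: eq_bigr => S _; case: ifPn => [/asboolP nS|/asboolP nS]; last first.
  by rewrite counted0.
have [|p xp] := @isproj_exists _ _ _ u c finset.set0 [set: 'I_m]%SET S x.
  by have [y Sy] := nS; exists y; apply: open_regionW.
have Sp : face_set S (active p) by exists p => //; case: xp.
rewrite (countedE _ nS xp) /face_dim finset.set0U.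
have FN A : face_set S A ->
    (\1_(face_plus_normal (cell S) (face S A)) x : int) = (A == active p)%:R.
  move=> SA; rewrite indicE; congr (nat_of_bool _)%:R.
  by apply/idP/eqP; rewrite inE => /(face_plus_normal_generic gx xp SA).
under eq_bigr => A /asboolP[SA _] do rewrite FN //.
have [dk|dk] := eqVneq (\dim (dir (active p))) k.
  rewrite (bigD1 (active p)) /=; last by apply/asboolP.
  by rewrite eqxx big1 ?addr0 // => A /andP[_ /negPf ->].
rewrite big1 // => A /asboolP[_ Ak]; case: eqVneq => // Ap.
by rewrite Ap in Ak; rewrite Ak eqxx in dk.
Qed.

Lemma coef_char_polynomial k :
  (char_polynomial wall)`_k = whitney u c k finset.set0 [set: 'I_m]%SET.
Proof.
rewrite /char_polynomial coef_sum /whitney.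
rewrite [RHS](eq_bigl predT) => [|B]; last by rewrite powersetE finset.subsetT.
rewrite big_mkcond /=; apply: eq_bigr => B _.
rewrite /whitney_term finset.set0U flat_wall.
case: ifPn => //= /asboolP[p Bp]; rewrite (affdim_flat Bp) coefZ coefXn eq_sym.
by case: eqP => _; rewrite ?mulr1 ?mulr0.
Qed.

(** Near x the generic points see at most the summands that x sees, because
    the sets F + N_F(P) are closed, and exactly those if x is on the boundary
    of none of them. *)
Lemma phi_near k x : exists2 x', generic u c x' &
  phi wall k x' <= phi wall k x /\
  (~ exceptional_set wall k x -> phi wall k x = phi wall k x').
Proof.
pose FN (SA : {set 'I_m} * {set 'I_m}) :=
  face_plus_normal (cell SA.1) (face SA.1 SA.2).
pose good SA := chamber SA.1 !=set0 /\ face_sets k SA.1 SA.2.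
have nearFN SA : nbhs x [set x' | good SA -> (FN SA x' -> FN SA x) /\
    (~ exceptional_set wall k x -> FN SA x -> FN SA x')].
  have [gSA|nSA] := pselect (good SA); last by apply: filterE => ? /nSA.
  have [nS [SA1 SAk]] := gSA.
  have [FNx|FNx] := pselect (FN SA x); last first.
    have oFN : open (~` FN SA) by apply/closed_openC/face_plus_normal_closed.
    have := open_nbhs_nbhs (conj oFN FNx).
    by apply: filterS => x' nx' _; split=> // /nx'.
  have [exc|nexc] := pselect (exceptional_set wall k x);
    first by apply: filterE.
  have intFN : interior (FN SA) x.
    apply: contrapT => nint; apply: nexc.
    exists (cell SA.1); first by rewrite chambersE; exists SA.1.
    exists (face SA.1 SA.2); first by rewrite facesE //; exists SA.2.
    by split.
  by apply: filterS intFN => x' FNx' _; split.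
have : nbhs x (interior [set x' | forall SA, good SA ->
    (FN SA x' -> FN SA x) /\
    (~ exceptional_set wall k x -> FN SA x -> FN SA x')]).
  by apply: nbhs_interior; apply: (filter_forall _ nearFN).
rewrite nbhsE => -[G [oG Gx] GP].
have [|x' [/GP/interior_subset x'x gx']] := @generic_dense _ _ _ u c G _ oG.
  by exists x.
exists x' => //; rewrite !phiE; split=> [|nexc].
  apply: ler_sum => S /asboolP nS; apply: ler_sum => A /asboolP SA.
  have [le_x _] := x'x (S, A) (conj nS SA); rewrite !indicE.
  case: (boolP (x' \in _)) => [|_]; last exact: ler0n.
  by rewrite inE => /le_x FNx; rewrite mem_set.
apply: eq_bigr => S /asboolP nS; apply: eq_bigr => A /asboolP SA.
have [le_x ge_x] := x'x (S, A) (conj nS SA); rewrite !indicE.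
congr (nat_of_bool _)%:R; apply/idP/idP; rewrite !inE;
  [exact: ge_x|exact: le_x].
Qed.

End Arrangement.

Theorem theorem1p4 (R : realType) (d m : nat) (H : 'I_m -> set 'rV[R]_d)
    (arrH : is_arrangement H) (a : 'I_d.+1 -> int)
    (chiE : char_polynomial H =
            \sum_(k < d.+1) ((-1) ^+ (d - k) * a k) *: 'X^k) :
  forall k : 'I_d.+1,
    (forall x : 'rV[R]_d, ~ exceptional_set H k x -> phi H k x = a k) /\
    (forall x : 'rV[R]_d, a k <= phi H k x).
Proof.
have [_ /choice[u /choice[c uc]]] := arrH.
have HE : H = wall u c by apply/funext => i; have [_ ->] := uc i.
move=> k; rewrite HE in chiE *.
have phi_ak x : generic u c x -> phi (wall u c) k x = a k.
  move=> gx; rewrite phi_generic //.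
  have := congr1 (fun p : {poly int} => p`_k) chiE.
  rewrite coef_char_polynomial (whitney_region_count _ _ _ gx) dim_dir0.
  rewrite coef_sum (bigD1 k) //= coefZ coefXn eqxx mulr1 big1 => [|l lk];
    last first.
    by rewrite coefZ coefXn eq_sym (negPf (_ : (l : nat) != k)) ?mulr0 //
      val_eqE.
  have -> : (-1) ^+ (d + k) = (-1) ^+ (d - k) :> int.
    by rewrite -signr_odd -[RHS]signr_odd oddB ?oddD // -ltnS.
  by rewrite addr0; apply: mulfI; rewrite signr_eq0.
split=> x; have [x' gx' [le_x' eq_x']] := phi_near u c k x.
  by move=> /eq_x' ->; apply: phi_ak.
by rewrite -(phi_ak _ gx').
Qed.
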